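(* Let $\mathcal{M}$ be a compact topological space and let $f = (f_0, f_1) : \mathcal{M} \to \mathbb{R}^2$ be continuous. Suppose that for each $t = (t_0,t_1) \in \mathbb{R}^2$ with $t_0 \ge 0$ and $t \ne 0$, the set $$\mathcal{M}_t = \Big\{ x \in \mathcal{M} : x \in \operatorname*{argmax}_{z \in \mathcal{M}} \langle t, f(z) \rangle \Big\}$$ is connected. Then the function $V_f : \mathbb{R} \to \mathbb{R}\cup\{-\infty\}$, $V_f(c) = \max\{ f_0(x) : f_1(x) = c,\ x \in \mathcal{M}\}$, is concave.
   Context: $\langle\cdot,\cdot\rangle$ is the Euclidean inner product. $V_f(c) = -\infty$ if $\{x \in \mathcal{M} : f_1(x) = c\}$ is empty; concavity of a function with values in $\mathbb{R}\cup\{-\infty\}$ is in the usual extended-valued sense (its hypograph is convex). *)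

(* Defs.v *)
From HB Require Import structures.
From mathcomp Require Import all_boot all_order all_algebra.
From mathcomp Require Import all_classical all_reals all_analysis.
Set Implicit Arguments.
Unset Strict Implicit.
Unset Printing Implicit Defensive.
Import Order.TTheory GRing.Theory Num.Theory.
Import numFieldNormedType.Exports.
Local Open Scope classical_set_scope.
Local Open Scope ring_scope.

Definition inner {R : realType} (s t : R * R) : R := s.1 * t.1 + s.2 * t.2.

Definition argmax {T : Type} {R : realType} (A : set T) (g : T -> R) : set T :=
  [set x | A x /\ forall z, A z -> g z <= g x].

Definition exposed {M : Type} {R : realType} (f : M -> R * R) (t : R * R) :
    set M :=
  argmax [set: M] (fun z => inner t (f z)).

Definition fiber {M : Type} {R : realType} (f : M -> R * R) (c : R) : set M :=
  [set x | (f x).2 = c].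

(* The set under [xget] has at most one element, the maximum of f_0 on the
   fiber. The default -oo is returned when there is no maximum; by [value_max]
   below this only happens on empty fibers if M is compact and f continuous. *)
Definition value {M : Type} {R : realType} (f : M -> R * R) (c : R) : \bar R :=
  xget -oo%E [set (f x).1%:E | x in argmax (fiber f c) (fun z => (f z).1)].

(* [R^o] provides the R-module structure that [convex_set] needs on R * R. *)
Definition hypograph {R : realType} (V : R -> \bar R) : set (R^o * R^o) :=
  [set p | (p.2%:E <= V p.1)%E].

Definition concave {R : realType} (V : R -> \bar R) : Prop :=
  convex_set (hypograph V).

Lemma value_empty {M : Type} {R : realType} (f : M -> R * R) (c : R) :
  fiber f c = set0 -> value f c = -oo%E.
Proof. by move=> f0; apply: xgetPN => v [x []]; rewrite f0. Qed.

Lemma value_argmax {M : Type} {R : realType} (f : M -> R * R) (c : R) (x : M) :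
  argmax (fiber f c) (fun z => (f z).1) x -> value f c = (f x).1%:E.
Proof.
move=> [xc xmax]; apply: xget_unique; first by exists x.
move=> _ [y [yc ymax] <-]; congr EFin.
by apply/eqP; rewrite eq_le xmax//= ymax.
Qed.

Lemma value_max {M : topologicalType} {R : realType} (f : M -> R * R) (c : R) :
  compact [set: M] -> continuous f -> fiber f c !=set0 ->
  exists2 x, argmax (fiber f c) (fun z => (f z).1) x & value f c = (f x).1%:E.
Proof.
move=> cM cf fc0.
have cf1 : continuous (fun z => (f z).1).
  by move=> x; apply: (cvg_comp _ _ (cf x)); exact: cvg_fst.
have cf2 : continuous (fun z => (f z).2).
  by move=> x; apply: (cvg_comp _ _ (cf x)); exact: cvg_snd.
have cfc : compact (fiber f c).
  rewrite -[fiber f c]setTI; apply: compact_closedI => //.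
  rewrite (_ : fiber f c = (fun z => (f z).2) @^-1` [set c])//.
  by apply: preimage_closed => [x _|]; [exact: cf2 | exact: closed_eq].
have [x xc xmax] : exists2 x, x \in fiber f c &
    forall z, z \in fiber f c -> (f z).1 <= (f x).1.
  by apply: compact_EVT_max => //; apply: continuous_subspaceT.
have xarg : argmax (fiber f c) (fun z => (f z).1) x.
  by split=> [|z zc]; [exact: set_mem | apply: xmax; exact: mem_set].
by exists x => //; exact: value_argmax.
Qed.

(* Main.v *)
(** For c strictly between two values of f_1, let h_-(s) and h_+(s) be the maxima
    of f_0 + s f_1 over {f_1 <= c} and {f_1 >= c}. Both are continuous in s, with
    h_+ <= h_- for s very negative and h_- <= h_+ for s very positive, so they agree
    at some s. Then M_(1,s) meets both sets, and being connected it contains a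
    point x with f_1(x) = c. The line of slope -s through (c, f_0(x)) lies above
    the graph of V_f and touches it at c. *)
Require Import Defs.
From HB Require Import structures.
From mathcomp Require Import all_boot all_order all_algebra.
From mathcomp Require Import all_classical all_reals all_analysis.
From mathcomp Require Import ring lra.
Import Order.TTheory GRing.Theory Num.Theory.
Import numFieldNormedType.Exports.
Local Open Scope classical_set_scope.
Local Open Scope ring_scope.

Lemma compact_argmax (R : realType) (T : topologicalType) (K : set T)
    (g : T -> R) :
  compact K -> K !=set0 -> continuous g -> argmax K g !=set0.
Proof.
move=> cK K0 cg; have [x Kx xmax] := compact_EVT_max K0 cK
  (continuous_subspaceT cg).
by exists x; split=> [|z Kz]; [exact: set_mem | apply: xmax; exact: mem_set].
Qed.

(** The maximum is Lipschitz in [s] with constant the maximum of [|g1|] on [K], because a maximizer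
    for one parameter competes at every other one. *)
Lemma affine_family_max (R : realType) (T : topologicalType) (K : set T)
    (g0 g1 : T -> R) :
  compact K -> K !=set0 -> continuous g0 -> continuous g1 ->
  exists2 h : R -> R, continuous h &
    forall s, exists2 x, argmax K (fun z => g0 z + s * g1 z) x &
      h s = g0 x + s * g1 x.
Proof.
move=> cK K0 cg0 cg1.
have /choice[m mP] s : exists x, argmax K (fun z => g0 z + s * g1 z) x.
  apply: compact_argmax => // x; apply: cvgD; first exact: cg0.
  by apply: cvgM; [exact: cvg_cst | exact: cg1].
exists (fun s => g0 (m s) + s * g1 (m s)); last by move=> s; exists (m s).
have [b [_ bmax]] : argmax K (fun z => `|g1 z|) !=set0.
  apply: compact_argmax => // x.
  by apply: (cvg_comp _ _ (cg1 x)); exact: norm_continuous.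
have lip s t : g0 (m s) + s * g1 (m s) - (g0 (m t) + t * g1 (m t)) <=
    `|g1 b| * `|s - t|.
  have [Ks _] := mP s; have [_ /(_ _ Ks) /= tmax] := mP t.
  apply: (@le_trans _ _ (g1 (m s) * (s - t))); first by lra.
  apply: (le_trans (ler_norm _)); rewrite normrM ler_wpM2r//.
  exact: bmax.
move=> s; apply/cvgrPdist_le => e e0; near=> t.
(* Adding 1 keeps the constant positive, so that [e] can be divided by it. *)
apply: (@le_trans _ _ ((`|g1 b| + 1) * `|s - t|)).
  have := lip t s; rewrite distrC; have := lip s t.
  have := normr_ge0 (s - t).
  rewrite ler_norml; lra.
rewrite mulrC -ler_pdivlMr ?ltr_wpDl//.
near: t; apply: cvgr_dist_le; first exact: cvg_id.
by rewrite divr_gt0 ?ltr_wpDl.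
Unshelve. all: by end_near. Qed.

Lemma exposed_fiber (R : realType) (M : topologicalType) (f : M -> R * R)
    (c : R) (a b : M) :
  compact [set: M] -> continuous f ->
  (forall s, connected (exposed f (1, s))) ->
  (f a).2 < c -> c < (f b).2 ->
  exists s, (exposed f (1, s) `&` fiber f c) !=set0.
Proof.
move=> cM cf cEx ac cb.
have cf1 : continuous (fun z => (f z).1).
  by move=> x; apply: (cvg_comp _ _ (cf x)); exact: cvg_fst.
have cf2 : continuous (fun z => (f z).2).
  by move=> x; apply: (cvg_comp _ _ (cf x)); exact: cvg_snd.
have cpre (C : set R) : closed C ->
    compact ((fun z => (f z).2) @^-1` C).
  move=> cC; rewrite -[X in compact X]setTI; apply: compact_closedI => //.
  by apply: preimage_closed => // x _; exact: cf2.
have [hL chL hLP] := affine_family_max _ _ _ _ _ (cpre _ (@closed_le R c))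
  (ex_intro _ a (ltW ac)) cf1 cf2.
have [hR chR hRP] := affine_family_max _ _ _ _ _ (cpre _ (@closed_ge R c))
  (ex_intro _ b (ltW cb)) cf1 cf2.
have [w [_ wmax]] : argmax [set: M] (fun z => (f z).1) !=set0.
  by apply: compact_argmax => //; exists a.
(* With [w] a global maximizer of f_0, [p] solves f_0(a) - p f_1(a) = f_0(w) - p c. The right side
   bounds f_0 - p f_1 on {f_1 >= c}, so at parameter [- p] the point [a] already beats that half.
   Symmetrically, [q] lets [b] beat {f_1 <= c}. *)
pose p := ((f w).1 - (f a).1) / (c - (f a).2).
pose q := ((f w).1 - (f b).1) / ((f b).2 - c).
have p0 : 0 <= p by rewrite divr_ge0 ?subr_ge0 ?wmax// ltW.
have q0 : 0 <= q by rewrite divr_ge0 ?subr_ge0 ?wmax// ltW.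
have pE : p * (c - (f a).2) = (f w).1 - (f a).1.
  by rewrite divfK// subr_eq0 gt_eqF.
have qE : q * ((f b).2 - c) = (f w).1 - (f b).1.
  by rewrite divfK// subr_eq0 gt_eqF.
have hp : 0 <= hL (- p) - hR (- p).
  have [x [_ /(_ a (ltW ac)) xa] ->] := hLP (- p).
  have [y [/= yc _] ->] := hRP (- p).
  have yw := wmax y Logic.I; have := ler_wpM2l p0 yc; lra.
have hq : hL q - hR q <= 0.
  have [x [_ /(_ b (ltW cb)) xb] ->] := hRP q.
  have [y [/= yc _] ->] := hLP q.
  have yw := wmax y Logic.I; have := ler_wpM2l q0 yc; lra.
have [|||s _ /eqP] := @IVT R (fun s => hL s - hR s) (- p) q 0.
- by lra.
- apply: continuous_subspaceT => s.
  by apply: cvgB; [exact: chL | exact: chR].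
- by rewrite ge_min le_max hp hq orbT.
rewrite subr_eq0 => /eqP hLR; exists s.
have [x [/= xc xmax] hx] := hLP s.
have [y [/= yc ymax] hy] := hRP s.
have inE z : inner (1, s) (f z) = (f z).1 + s * (f z).2.
  by rewrite /inner mul1r.
(* The two halves cover [M], so the common value [hL s = hR s] is the global maximum. *)
have exP u : (f u).1 + s * (f u).2 = hL s -> exposed f (1, s) u.
  move=> uE; split=> // z _; rewrite !inE uE.
  by case: (leP (f z).2 c) => [zc|/ltW zc];
    [rewrite hx; exact: xmax | rewrite hLR hy; exact: ymax].
have [z zs zc] : [set (f z).2 | z in exposed f (1, s)] c.
  have /connected_intervalP itv := connected_continuous_connected (cEx s)
    (continuous_subspaceT cf2).
  apply: (itv (f x).2 (f y).2); last by rewrite xc yc.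
  - by exists x => //; exact: exP.
  - by exists y => //; apply: exP; rewrite hLR.
by exists z.
Qed.

Theorem theorem2p1 (R : realType) (M : topologicalType) (f : M -> R * R)
    (compactM : compact [set: M])
    (continuousf : continuous f)
    (connectedMt : forall t : R * R, 0 <= t.1 -> t <> (0, 0) ->
       connected (exposed f t)) :
  concave (value f).
Proof.
(* A point of the hypograph has a real ordinate, which excludes the value -oo and hence an empty
   fiber. *)
have attained (p : R^o * R^o) : hypograph (value f) p ->
    exists2 x, argmax (fiber f p.1) (fun z => (f z).1) x & p.2 <= (f x).1.
  rewrite /hypograph /= => hp.
  have [f0|/set0P fN0] := eqVneq (fiber f p.1) set0.
    by move: hp; rewrite value_empty.
  have [x xmax vx] := value_max compactM continuousf fN0.
  by exists x => //; rewrite -lee_fin -vx.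
apply/convex_setW => p q /set_mem hp /set_mem hq k k0 k1; apply/mem_set.
have [a amax pa] := attained p hp; have [b bmax qb] := attained q hq.
have [ap _] := amax; have [bq _] := bmax.
rewrite /fiber /= in ap bq.
set r : R := k%:num in k0 k1.
rewrite /hypograph /=.
change (((r * p.2 + (1 - r) * q.2)%:E <= value f (r * p.1 + (1 - r) * q.1))%E).
have rp : r * p.2 <= r * (f a).1 by rewrite ler_wpM2l// ltW.
have rq : (1 - r) * q.2 <= (1 - r) * (f b).1.
  by rewrite ler_wpM2l// subr_ge0 ltW.
(* On a vertical segment, [c] is not strictly between two values of f_1; there both ordinates lie
   below the same maximum f_0(a). *)
have [pq|pq] := eqVneq p.1 q.1.
  have -> : r * p.1 + (1 - r) * q.1 = p.1 by rewrite -pq; ring.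
  have bm : (f b).1 <= (f a).1 by apply: (proj2 amax); rewrite /fiber /= pq.
  have : (1 - r) * (f b).1 <= (1 - r) * (f a).1.
    by rewrite ler_wpM2l// subr_ge0 ltW.
  rewrite (value_argmax amax) lee_fin; lra.
set c := r * p.1 + (1 - r) * q.1.
have [s [x [[_ xmax] xc]]] :
    exists s, (exposed f (1, s) `&` fiber f c) !=set0.
  have ex u v : (f u).2 < c -> c < (f v).2 ->
      exists s, (exposed f (1, s) `&` fiber f c) !=set0.
    apply: exposed_fiber => // s; apply: connectedMt => //=.
    by case=> /eqP; rewrite oner_eq0.
  (* Since 0 < r < 1, these identities place [c] strictly between [p.1] and [q.1], in whichever
     order they come. *)
  have cp : c - p.1 = (1 - r) * (q.1 - p.1) by rewrite /c; ring.
  have cq : q.1 - c = r * (q.1 - p.1) by rewrite /c; ring.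
  have [lt_pq|lt_qp|] := ltgtP p.1 q.1; [apply: (ex a b)|apply: (ex b a)|].
  - by rewrite ap -subr_gt0 cp mulr_gt0 ?subr_gt0.
  - by rewrite bq -subr_gt0 cq mulr_gt0 ?subr_gt0.
  - by rewrite bq -subr_lt0 cq pmulr_rlt0 ?subr_lt0.
  - by rewrite ap -subr_lt0 cp pmulr_rlt0 ?subr_lt0 ?subr_gt0.
  - by move=> e; rewrite e eqxx in pq.
have line z : (f z).1 + s * (f z).2 <= (f x).1 + s * c.
  by have := xmax z Logic.I; rewrite /inner /= !mul1r xc.
have xarg : argmax (fiber f c) (fun z => (f z).1) x.
  by split=> // z zc; have := line z; rewrite zc lerD2r.
rewrite (value_argmax xarg) lee_fin.
(* Adding the line bounds at [a] and [b] with weights r and 1 - r cancels the terms in [s], as the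
   abscissas average to [c]. *)
have ra : r * ((f a).1 + s * p.1) <= r * ((f x).1 + s * c).
  by rewrite ler_wpM2l ?(ltW k0)// -ap.
have rb : (1 - r) * ((f b).1 + s * q.1) <= (1 - r) * ((f x).1 + s * c).
  by rewrite ler_wpM2l ?subr_ge0 ?(ltW k1)// -bq.
rewrite /c in ra rb; lra.
Qed.
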